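(* Consider either the Fokker-Planck scheme with a discrete Maxwellian satisfying (A-FP), or the BGK scheme with a discrete Maxwellian satisfying (A-BGK) (all defined in the context), and assume that the number $N$ of points of the space discretization is odd. Let $\Delta t_{\max}>0$ be arbitrary. Then there are constants $C\ge1$ and $\beta>0$ such that for all $\varepsilon\in(0,1)$, all $\Delta t\in(0,\Delta t_{\max}]$ and all initial data $(f_{ij}^0)_{i\in\mathcal I,j\in\mathcal J}$, the solution $(f_{ij}^n)_{i\in\mathcal I,j\in\mathcal J,n\in\mathbb N}$ of the scheme satisfies, for all $n\in\mathbb N$, $$\|f^n-\mu_f\mathcal M\|_{2,\gamma}\le C\,\|f^0-\mu_f\mathcal M\|_{2,\gamma}\,e^{-\frac{\beta}{2}t^n}.$$ Moreover, the constants $C$ and $\beta$ do not depend on the size of the discretization $\delta$: for fixed $\Delta t_{\max}$ and fixed bounds $\underline m_2,\overline m_2,\overline m_4$, they can be chosen the same for all space and velocity meshes (with $N$ odd) and all admissible discrete Maxwellians.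
   Context: Velocity mesh. Fix $v_\star>0$ and an integer $L\ge1$. Interfaces $v_{j+1/2}$, $j=-L,\dots,L$, are strictly increasing with $v_{-L+1/2}=-v_\star$, $v_{1/2}=0$, $v_{L+1/2}=v_\star$ and $v_{j+1/2}=-v_{-j+1/2}$ for $j=0,\dots,L$. Let $\mathcal J=\{-L+1,\dots,L\}$; for $j\in\mathcal J$ the cell $(v_{j-1/2},v_{j+1/2})$ has length $\Delta v_j$ and midpoint $v_j$. Let $\mathcal J^*=\{-L,\dots,L\}$, $v_{-L}:=-v_\star$, $v_{L+1}:=v_\star$ and $\Delta v_{j+1/2}=v_{j+1}-v_j$ for $j\in\mathcal J^*$. Space and time mesh. The torus of length $1$ is divided into $N$ consecutive intervals indexed by $\mathcal I=\mathbb Z/N\mathbb Z$, of lengths $\Delta x_i>0$ with $\sum_i\Delta x_i=1$. The size of the discretization is $\delta=\max(\max_i\Delta x_i,\max_j\Delta v_j)$. $\Delta t>0$ is the time step and $t^n=n\Delta t$. Discrete Maxwellians. Let $0<\underline m_2\le\overline m_2$ and $\overline m_4$ be fixed constants, and $m_k^{\Delta v}=\sum_{j\in\mathcal J}|v_j|^k\mathcal M_j\Delta v_j$. (A-BGK): $(\mathcal M_j)_{j\in\mathcal J}$ satisfies $\mathcal M_j>0$ for all $j\in\mathcal J$, $\mathcal M_j=\mathcal M_{-j+1}$ for $j=1,\dots,L$, $\sum_{j\in\mathcal J}\mathcal M_j\Delta v_j=1$, $\underline m_2\le m_2^{\Delta v}\le\overline m_2$, $m_4^{\Delta v}\le\overline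 m_4$. (A-FP): $(\mathcal M^*_{j+1/2})_{j\in\mathcal J^*}$ satisfies $\mathcal M^*_{j+1/2}=\mathcal M^*_{-j+1/2}$ for $j\in\mathcal J^*$, $\mathcal M^*_{L+1/2}=\mathcal M^*_{-L+1/2}=0$, $\mathcal M_j:=\frac{\mathcal M^*_{j-1/2}-\mathcal M^*_{j+1/2}}{v_j\Delta v_j}>0$ for $j\in\mathcal J$, $\sum_{j\in\mathcal J}\mathcal M_j\Delta v_j=1$, $\underline m_2\le m_2^{\Delta v}\le\overline m_2$, $m_4^{\Delta v}\le\overline m_4$. Schemes ($\varepsilon>0$). Transport flux: $\mathcal F^{n}_{i+1/2,j}=v_j\frac{f^n_{i+1,j}+f^n_{ij}}2\Delta v_j$. Fokker-Planck scheme: for all $i\in\mathcal I,j\in\mathcal J,n\ge0$, $$\varepsilon\Delta x_i\Delta v_j(f_{ij}^{n+1}-f_{ij}^n)+\Delta t(\mathcal F^{n+1}_{i+1/2,j}-\mathcal F^{n+1}_{i-1/2,j})=\frac{\Delta t}{\varepsilon}(\mathcal G^{n+1}_{i,j+1/2}-\mathcal G^{n+1}_{i,j-1/2}),$$ where $\mathcal G^{n}_{i,j+1/2}=\mathcal M^*_{j+1/2}\left(\frac{f^n_{i,j+1}}{\mathcal M_{j+1}}-\frac{f^n_{ij}}{\mathcal M_j}\right)\frac{\Delta x_i}{\Delta v_{j+1/2}}$ for $j\in\mathcal J^*\setminus\{-L,L\}$ and $\mathcal G^n_{i,-L+1/2}=\mathcal G^n_{i,L+1/2}=0$. BGK scheme: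 for all $i\in\mathcal I,j\in\mathcal J,n\ge0$, $$\varepsilon\Delta x_i\Delta v_j(f_{ij}^{n+1}-f_{ij}^n)+\Delta t(\mathcal F^{n+1}_{i+1/2,j}-\mathcal F^{n+1}_{i-1/2,j})=\frac{\Delta t}{\varepsilon}\Delta x_i\Delta v_j(\rho_i^{n+1}\mathcal M_j-f_{ij}^{n+1}),\quad \rho_i^n=\sum_{j\in\mathcal J}\Delta v_jf_{ij}^n.$$ Each scheme has a unique solution for given initial data. Notation. $\gamma_j=1/\mathcal M_j$; $\|g\|_{2,\gamma}^2=\sum_{(i,j)\in\mathcal I\times\mathcal J}|g_{ij}|^2\gamma_j\Delta x_i\Delta v_j$; $\mu_f=\sum_{(i,j)\in\mathcal I\times\mathcal J}\Delta x_i\Delta v_jf_{ij}^0$; $\mu_f\mathcal M$ denotes the array with entries $\mu_f\mathcal M_j$. *)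

(* Defs.v *)
From HB Require Import structures.
From mathcomp Require Import all_boot all_order all_algebra.
From mathcomp Require Import reals.

Set Implicit Arguments.
Unset Strict Implicit.
Unset Printing Implicit Defensive.

Import Order.TTheory GRing.Theory Num.Theory.
Local Open Scope ring_scope.

(* Velocity indices j are integers; half-integer indices are encoded by their
   integer part: [vface V j] is v_{j+1/2}, and likewise for M^* and G.
   Families indexed by velocity are functions on [int] whose values outside
   J = {-L+1, ..., L} (cells) or J^* = {-L, ..., L} (interfaces) are
   irrelevant. *)

Record velocity_mesh (R : realType) := VelocityMesh {
  vstar : R;
  vsize : nat; (* L *)
  vface : int -> R;
  vstar_gt0 : 0 < vstar;
  vsize_ge1 : (1 <= vsize)%N;
  vface_incr : forall j k : int,
    - vsize%:Z <= j -> j < k -> k <= vsize%:Z -> vface j < vface k;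
  vface_left : vface (- vsize%:Z) = - vstar;
  vface_mid : vface 0 = 0;
  vface_right : vface vsize%:Z = vstar;
  vface_sym : forall j : int,
    0 <= j <= vsize%:Z -> vface j = - vface (- j)
}.

(* The torus: the neighbours i + 1 and i - 1 in Z/NZ are [ordS i] and
   [ord_pred i]; unlike 'Z_N this is also correct for N = 1. *)
Record space_mesh (R : realType) := SpaceMesh {
  xsize : nat; (* N *)
  dx : 'I_xsize -> R;
  dx_gt0 : forall i, 0 < dx i;
  dx_sum : \sum_i dx i = 1
}.

Section VelocityMeshDefs.
Variables (R : realType) (V : velocity_mesh R).
Local Notation L := (vsize V)%:Z.

Definition inJ (j : int) : bool := - L + 1 <= j <= L.
Definition inJstar (j : int) : bool := - L <= j <= L.

(* \sum_{j in J} F j *)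
Definition sumJ (F : int -> R) : R :=
  \sum_(k < (vsize V).*2) F (k%:Z - L + 1).

(* v_j: cell midpoints, with the conventions v_{-L} = -v_star and
   v_{L+1} = v_star *)
Definition vel (j : int) : R :=
  if j == - L then - vstar V
  else if j == L + 1 then vstar V
  else (vface V (j - 1) + vface V j) / 2.

Definition dv (j : int) : R := vface V j - vface V (j - 1).

(* Delta v_{j+1/2} *)
Definition dvface (j : int) : R := vel (j + 1) - vel j.

Definition moment (M : int -> R) (k : nat) : R :=
  sumJ (fun j => `|vel j| ^+ k * M j * dv j).

Definition A_BGK (m2lo m2hi m4hi : R) (M : int -> R) : Prop :=
  [/\ forall j, inJ j -> 0 < M j,
      forall j : int, 1 <= j <= L -> M j = M (- j + 1),
      sumJ (fun j => M j * dv j) = 1,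
      m2lo <= moment M 2 <= m2hi
    & moment M 4 <= m4hi].

(* The cell Maxwellian (M_j) attached to the interface values
   [Ms j] = M^*_{j+1/2} *)
Definition maxwellian_of (Ms : int -> R) (j : int) : R :=
  (Ms (j - 1) - Ms j) / (vel j * dv j).

Definition A_FP (m2lo m2hi m4hi : R) (Ms : int -> R) : Prop :=
  let M := maxwellian_of Ms in
  [/\ forall j, inJstar j -> Ms j = Ms (- j),
      Ms L = 0 /\ Ms (- L) = 0,
      forall j, inJ j -> 0 < M j,
      sumJ (fun j => M j * dv j) = 1
    & m2lo <= moment M 2 <= m2hi /\ moment M 4 <= m4hi].

End VelocityMeshDefs.

Section SchemeDefs.
Variables (R : realType) (V : velocity_mesh R) (X : space_mesh R).
Local Notation L := (vsize V)%:Z.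
Local Notation I := 'I_(xsize X).
Implicit Types (g : I -> int -> R) (f : nat -> I -> int -> R).

(* F_{i+1/2,j} *)
Definition transport_flux g (i : I) (j : int) : R :=
  vel V j * ((g (ordS i) j + g i j) / 2) * dv V j.

(* G_{i,j+1/2} *)
Definition FP_flux (Ms : int -> R) g (i : I) (j : int) : R :=
  let M := maxwellian_of V Ms in
  if (j == - L) || (j == L) then 0
  else Ms j * (g i (j + 1) / M (j + 1) - g i j / M j)
         * (dx i / dvface V j).

Definition density g (i : I) : R := sumJ V (fun j => dv V j * g i j).

Definition FP_scheme (Ms : int -> R) (eps dt : R) f : Prop :=
  forall (n : nat) (i : I) (j : int), inJ V j ->
    eps * dx i * dv V j * (f n.+1 i j - f n i j)
    + dt * (transport_flux (f n.+1) i j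
            - transport_flux (f n.+1) (ord_pred i) j)
    = dt / eps * (FP_flux Ms (f n.+1) i j - FP_flux Ms (f n.+1) i (j - 1)).

Definition BGK_scheme (M : int -> R) (eps dt : R) f : Prop :=
  forall (n : nat) (i : I) (j : int), inJ V j ->
    eps * dx i * dv V j * (f n.+1 i j - f n i j)
    + dt * (transport_flux (f n.+1) i j
            - transport_flux (f n.+1) (ord_pred i) j)
    = dt / eps * dx i * dv V j * (density (f n.+1) i * M j - f n.+1 i j).

(* ||g||_{2,gamma} with gamma_j = 1 / M_j *)
Definition norm2g (M : int -> R) g : R :=
  Num.sqrt
    (\sum_(i : I) sumJ V (fun j => `|g i j| ^+ 2 * (M j)^-1 * dx i * dv V j)).

(* mu_f for f^0 = g *)
Definition mass g : R :=
  \sum_(i : I) sumJ V (fun j => dx i * dv V j * g i j).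

(* ||f^n - mu_f M||_{2,gamma} *)
Definition dist_eq (M : int -> R) f (n : nat) : R :=
  norm2g M (fun i j => f n i j - mass (f 0%N) * M j).

End SchemeDefs.

(* Main.v *)
Require Import Defs.
From mathcomp Require Import all_boot all_order all_algebra.
From mathcomp Require Import reals sequences exp.
From mathcomp Require Import ring lra zify.

(* Write rho for the density of f, h = f - rho M for its kinetic part and
   j = sum_k v_k f_k dv_k. Both collision operators conserve mass, send j to -j,
   and dissipate at least |h|^2 (for Fokker-Planck this is the Gaussian Poincare
   inequality with constant 1), and only these properties are used.
   For N odd the centered difference D satisfies |u| <= 2 |D u| on mean-zero
   arrays whatever the mesh, so w = D^-1 rho is well defined, and the mass
   balance reads w' - w = -(dt/eps) (j' - mean j'). Since D is skew-symmetric,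
   testing the momentum balance against w produces the missing dissipation
   |rho|^2 together with terms controlled by |h|; hence
   |f|^2 / 2 - eta eps <j, w> is, for small eta, equivalent to |f|^2 and decays
   geometrically. *)

Set Implicit Arguments.
Unset Strict Implicit.
Unset Printing Implicit Defensive.

Import Order.TTheory GRing.Theory Num.Theory.
Local Open Scope ring_scope.

(** * Identities and inequalities for finite sums *)

Section Sums.
Variable R : realType.

(** Lagrange's identity: the double sum of [p j * p k * (x j * y k - x k * y j) ^+ 2] is twice the
    gap between the two sides. *)
Lemma cauchy_schwarz_weighted (K : finType) (p x y : K -> R) :
  (forall k, 0 <= p k) ->
  (\sum_k p k * (x k * y k)) ^+ 2
    <= (\sum_k p k * x k ^+ 2) * (\sum_k p k * y k ^+ 2).
Proof.
move=> p0.
have : 0 <= \sum_j \sum_k p j * p k * (x j * y k - x k * y j) ^+ 2.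
  by do 2 (apply: sumr_ge0 => ? _); rewrite mulr_ge0 ?sqr_ge0 ?mulr_ge0.
have -> : \sum_j \sum_k p j * p k * (x j * y k - x k * y j) ^+ 2 =
    \sum_j \sum_k ((p j * x j ^+ 2) * (p k * y k ^+ 2)
    + (p j * y j ^+ 2) * (p k * x k ^+ 2)
    - 2 * (p j * (x j * y j)) * (p k * (x k * y k))).
  by apply: eq_bigr => j _; apply: eq_bigr => k _; ring.
under eq_bigr => j _ do rewrite sumrB big_split /=.
rewrite sumrB big_split /= -!big_distrlr /= -mulr_sumr; lra.
Qed.

(** Symmetrized form of a covariance; it lets two covariances be compared term by term over
    pairs. *)
Lemma covariance_sum (n : nat) (p x y : nat -> R) :
  \sum_(k < n) p k = 1 ->
  \sum_(j < n) \sum_(k < n) p j * p k * ((x k - x j) * (y k - y j)) =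
  2 * (\sum_(k < n) p k * (x k * y k)
       - (\sum_(k < n) p k * x k) * (\sum_(k < n) p k * y k)).
Proof.
move=> p1.
have -> : \sum_(j < n) \sum_(k < n) p j * p k * ((x k - x j) * (y k - y j)) =
    \sum_(j < n) \sum_(k < n) (p j * (p k * (x k * y k))
    + (p j * (x j * y j)) * p k
    - ((p j * x j) * (p k * y k) + (p j * y j) * (p k * x k))).
  by apply: eq_bigr => j _; apply: eq_bigr => k _; ring.
under eq_bigr => j _ do rewrite sumrB !big_split /=.
rewrite sumrB !big_split /= -!big_distrlr /= p1; ring.
Qed.

(** Abel summation with [a] living on interfaces and [u] on cells, hence one more value of [a]. *)
Lemma sum_by_parts (n : nat) (a u : nat -> R) :
  \sum_(k < n.+1) (a k - a k.+1) * u k =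
  a 0%N * u 0%N - a n.+1 * u n + \sum_(k < n) a k.+1 * (u k.+1 - u k).
Proof.
elim: n => [|n IH]; first by rewrite big_ord_recr !big_ord0 /=; ring.
by rewrite big_ord_recr /= IH [in RHS]big_ord_recr /=; ring.
Qed.

End Sums.

(** * Gaussian Poincare inequality in discrete velocity *)

Section FokkerPlanckSpectralGap.
Variable R : realType.

(** Cauchy-Schwarz along the path from j to k, adding one edge at a time. The two monotonicity
    claims supply the signs that the induction step needs. *)
Lemma sqr_incr_le_cumul (n : nat) (v q : nat -> R) (j k : nat) :
  (forall l, (l < n)%N -> v l < v l.+1) -> (j <= k <= n)%N ->
  let Phi m := \sum_(l < m) (q l.+1 - q l) ^+ 2 / (v l.+1 - v l) in
  [/\ v j <= v k, Phi j <= Phi k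
    & (q k - q j) ^+ 2 <= (v k - v j) * (Phi k - Phi j)].
Proof.
move=> vincr /andP[jk kn] Phi.
elim: k jk kn => [|k IH]; first by rewrite leqn0 => /eqP -> _; split; lra.
rewrite leq_eqVlt => /predU1P[<- _|]; first by split; lra.
rewrite ltnS => jk kn; have [v_jk Phi_jk q_jk] := IH jk (ltnW kn).
have vk := vincr k kn.
have -> : Phi k.+1 = Phi k + (q k.+1 - q k) ^+ 2 / (v k.+1 - v k).
  by rewrite /Phi big_ord_recr.
set t := v k.+1 - v k; have t0 : 0 < t by rewrite /t; lra.
set B := (q k.+1 - q k) ^+ 2 / t.
have B0 : 0 <= B by rewrite divr_ge0 ?sqr_ge0 ?ltW.
split; [by lra|by lra|].
set y := q k.+1 - q k in B B0 *.
have yE : y ^+ 2 = t * B by rewrite /B mulrC divfK ?gt_eqF.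
set x := q k - q j in q_jk *; set s := v k - v j in q_jk *.
set A := Phi k - Phi j in q_jk *.
have -> : q k.+1 - q j = x + y by rewrite /x /y; ring.
have -> : v k.+1 - v j = s + t by rewrite /s /t; ring.
have -> : Phi k + B - Phi j = A + B by rewrite /A; ring.
have s0 : 0 <= s by rewrite /s; lra.
have A0 : 0 <= A by rewrite /A; lra.
(* AM-GM: [2 x y <= s B + t A], because [(x y)^2 <= (s B) (t A)]. *)
clearbody B y t x s A.
suff : 2 * (x * y) <= s * B + t * A by rewrite sqrrD yE mulr2n; move: q_jk; lra.
apply: le_trans (ler_norm _) _.
rewrite -ler_sqr ?nnegrE ?normr_ge0 ?addr_ge0 ?mulr_ge0 // ?(ltW t0) //.
rewrite real_normK ?num_real // !exprMn yE.
have : x ^+ 2 * (t * B) <= s * A * (t * B).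
  by rewrite ler_wpM2r // mulr_ge0 // ltW.
by have := sqr_ge0 (s * B - t * A); nra.
Qed.

(* Phi, the cumulated sum of [(dq)^2 / dv], turns Cauchy-Schwarz along the path
   from j to k into (q_k - q_j)^2 <= (v_k - v_j) (Phi_k - Phi_j). Averaging, the
   variance of q is at most the covariance of v and Phi, which summation by
   parts converts into the right-hand side. *)
Lemma discrete_gaussian_poincare (n : nat) (v a p q : nat -> R) :
  (forall l, (l < n)%N -> v l < v l.+1) ->
  (forall k, (k <= n)%N -> 0 <= p k) ->
  (forall k, (k <= n)%N -> a k - a k.+1 = v k * p k) ->
  a 0%N = 0 -> a n.+1 = 0 -> \sum_(k < n.+1) p k = 1 ->
  \sum_(k < n.+1) p k * (q k - \sum_(j < n.+1) p j * q j) ^+ 2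
    <= \sum_(k < n) a k.+1 * ((q k.+1 - q k) ^+ 2 / (v k.+1 - v k)).
Proof.
move=> vincr p0 av a0 an p1.
pose Phi m := \sum_(l < m) (q l.+1 - q l) ^+ 2 / (v l.+1 - v l).
have -> : \sum_(k < n) a k.+1 * ((q k.+1 - q k) ^+ 2 / (v k.+1 - v k)) =
    \sum_(k < n.+1) p k * (v k * Phi k).
  have -> : \sum_(k < n.+1) p k * (v k * Phi k) =
      \sum_(k < n.+1) (a k - a k.+1) * Phi k.
    by apply: eq_bigr => k _; rewrite av -1?ltnS // mulrA [p _ * _]mulrC.
  rewrite sum_by_parts a0 an !mul0r subr0 add0r; apply: eq_bigr => k _.
  by rewrite /Phi big_ord_recr /= addrAC subrr add0r.
(* Summation by parts against 1: [v] has zero mean, so the mean of [v * Phi] is a covariance. *)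
have pv : \sum_(k < n.+1) p k * v k = 0.
  under eq_bigr => k _ do rewrite mulrC -av -1?ltnS // -[_ - _]mulr1.
  rewrite (sum_by_parts n a (fun=> 1)) a0 an !mul0r subr0 add0r big1 // => k _.
  by rewrite subrr mulr0.
set qbar := \sum_(j < n.+1) p j * q j.
have -> : \sum_(k < n.+1) p k * (q k - qbar) ^+ 2 =
    \sum_(k < n.+1) p k * (q k * q k) - qbar * qbar.
  have -> : \sum_(k < n.+1) p k * (q k - qbar) ^+ 2 =
      \sum_(k < n.+1) (p k * (q k * q k) - 2 * qbar * (p k * q k)
        + qbar ^+ 2 * p k).
    by apply: eq_bigr => k _; ring.
  by rewrite big_split /= sumrB -!mulr_sumr p1 -/qbar; ring.
have := @covariance_sum R n.+1 p q q p1.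
have := @covariance_sum R n.+1 p v Phi p1.
rewrite pv mul0r subr0 -/qbar => HPhi Hq.
rewrite -(ler_pM2l (ltr0Sn R 1)) -Hq -HPhi.
apply: ler_sum => j _; apply: ler_sum => k _.
have jn : (j <= n)%N by rewrite -ltnS.
have kn : (k <= n)%N by rewrite -ltnS.
apply: ler_wpM2l; first by rewrite mulr_ge0 ?p0.
have [jk|/ltnW kj] := leqP j k.
  have [|_ _] := @sqr_incr_le_cumul n v q j k vincr; first by rewrite jk kn.
  by rewrite expr2.
(* Swapping j and k changes the sign of both factors, so their product is unchanged. *)
have [|_ _] := @sqr_incr_le_cumul n v q k j vincr; rewrite ?kj ?jn //.
rewrite -/(Phi j) -/(Phi k) expr2; nra.
Qed.

End FokkerPlanckSpectralGap.

(** * Centered differences on the torus *)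

Section Torus.
Variables (R : realType) (X : space_mesh R).
Local Notation I := 'I_(xsize X).
Implicit Types (u w : I -> R) (c : R).

Definition ip u w : R := \sum_i dx i * (u i * w i).

(** Difference of the two interface averages over the cell length, so that [dx i * cdiff u i] is the
    transport difference of the schemes on a nonuniform mesh. *)
Definition cdiff u (i : I) : R := (u (ordS i) - u (ord_pred i)) / (2 * dx i).

Definition mean u : R := \sum_i dx i * u i.

Lemma eq_ip u u' w w' : u =1 u' -> w =1 w' -> ip u w = ip u' w'.
Proof. by move=> uE wE; apply: eq_bigr => i _; rewrite uE wE. Qed.

Lemma ipC u w : ip u w = ip w u.
Proof. by apply: eq_bigr => i _; rewrite [u i * _]mulrC. Qed.

Lemma ip_combl c u u' w : ip (fun i => u i + c * u' i) w = ip u w + c * ip u' w.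
Proof.
rewrite /ip mulr_sumr -big_split /=; apply: eq_bigr => i _; ring.
Qed.

Lemma ip_combr c u w w' : ip u (fun i => w i + c * w' i) = ip u w + c * ip u w'.
Proof. by rewrite ipC ip_combl !(ipC u). Qed.

Lemma ip_ge0 u : 0 <= ip u u.
Proof.
apply: sumr_ge0 => i _.
by rewrite mulr_ge0 ?(ltW (dx_gt0 i)) // -expr2 sqr_ge0.
Qed.

Lemma ip_young c u w : 0 < c -> 2 * ip u w <= c * ip u u + c^-1 * ip w w.
Proof.
move=> c0; have := ip_ge0 (fun i => u i + - c^-1 * w i).
rewrite !ip_combl !ip_combr (ipC w u) => H.
rewrite -subr_ge0.
have -> : c * ip u u + c^-1 * ip w w - 2 * ip u w =
  c * (ip u u + - c^-1 * ip u w + - c^-1 * (ip u w + - c^-1 * ip w w)).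
  by field; rewrite gt_eqF.
by rewrite mulr_ge0 // ltW.
Qed.

Lemma ip_youngN c u w : 0 < c -> - (2 * ip u w) <= c * ip u u + c^-1 * ip w w.
Proof.
move=> c0; have := ip_ge0 (fun i => u i + c^-1 * w i).
rewrite !ip_combl !ip_combr (ipC w u) => H.
rewrite -subr_ge0.
have -> : c * ip u u + c^-1 * ip w w - - (2 * ip u w) =
  c * (ip u u + c^-1 * ip u w + c^-1 * (ip u w + c^-1 * ip w w)).
  by field; rewrite gt_eqF.
by rewrite mulr_ge0 // ltW.
Qed.

Lemma mean_ip u : mean u = ip u (fun=> 1).
Proof. by apply: eq_bigr => i _; rewrite mulr1. Qed.

Lemma mean_comb c u u' : mean (fun i => u i + c * u' i) = mean u + c * mean u'.
Proof. by rewrite !mean_ip ip_combl. Qed.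

Lemma mean_const c : mean (fun=> c) = c.
Proof. by rewrite /mean -mulr_suml dx_sum mul1r. Qed.

Lemma ip_center u : ip u (fun i => u i + - mean u * 1) = ip u u - mean u ^+ 2.
Proof. by rewrite ip_combr -mean_ip; ring. Qed.

Lemma ip_center_le u :
  let u0 i := u i + - mean u * 1 in ip u0 u0 <= ip u u.
Proof.
rewrite /= ip_combl ip_center ipC -mean_ip mean_comb mean_const.
by have := sqr_ge0 (mean u); lra.
Qed.

Lemma cdiff_comb c u u' (i : I) :
  cdiff (fun i => u i + c * u' i) i = cdiff u i + c * cdiff u' i.
Proof. by rewrite /cdiff; ring. Qed.

Lemma cdiff_sum (K : finType) (c : K -> R) (u : I -> K -> R) (i : I) :
  cdiff (fun i => \sum_k c k * u i k) i = \sum_k c k * cdiff (u^~ k) i.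
Proof.
rewrite /cdiff -sumrB mulr_suml; apply: eq_bigr => k _; ring.
Qed.

Lemma dx_cdiff u (i : I) : dx i * cdiff u i = (u (ordS i) - u (ord_pred i)) / 2.
Proof. by rewrite /cdiff; field; rewrite gt_eqF ?dx_gt0. Qed.

(** The lengths cancel against the denominators of [cdiff], and a shift of the cycle exchanges the
    two neighbours. *)
Lemma ip_cdiff u w : ip (cdiff u) w = - ip u (cdiff w).
Proof.
have E u' w' : ip (cdiff u') w' =
    (\sum_i u' (ordS i) * w' i - \sum_i u' (ord_pred i) * w' i) / 2.
  rewrite -sumrB mulr_suml; apply: eq_bigr => i _.
  by rewrite mulrA dx_cdiff; ring.
have S u' w' : \sum_(i : I) u' (ordS i) * w' i = \sum_i w' (ord_pred i) * u' i.
  rewrite [RHS](reindex_inj (@ordS_inj _)) /=.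
  by apply: eq_bigr => i _; rewrite ordSK mulrC.
by rewrite [ip u _]ipC !E (S u w) (S w u); ring.
Qed.

Lemma mean_cdiff u : mean (cdiff u) = 0.
Proof.
rewrite mean_ip ip_cdiff /ip big1 ?oppr0 // => i _.
by rewrite /cdiff subrr mul0r !mulr0.
Qed.

Lemma val_iter_ordS m (i : I) :
  iter m (@ordS _) i = ((i + m) %% xsize X)%N :> nat.
Proof.
elim: m => [|m IH]; first by rewrite addn0 modn_small.
by rewrite iterS /= IH -addn1 modnDml addn1 addnS.
Qed.

(** * Odd number of cells: Poincare inequality and inversion of the centered difference *)

Section OddSize.
Hypothesis oddX : odd (xsize X).

(** 2 is invertible modulo an odd N. The offset [b] is 0 for the cells visited by strides of two and
    1 for the cells jumped over. *)
Lemma iter2_ordS_inj b (i : I) :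
  injective (fun t : I => iter (t.*2 + b)%N (@ordS _) i).
Proof.
move=> s t /(congr1 val); rewrite /= !val_iter_ordS => /eqP E.
have {}E : s.*2 == t.*2 %[mod xsize X]%N.
  by move: E; rewrite !addnA eqn_modDr eqn_modDl.
apply: val_inj => /=.
wlog st : s t E / (s <= t)%N.
  by move=> H; case: (leqP s t) => [/H->//|/ltnW /H-> //]; rewrite eq_sym.
move: E; rewrite eq_sym eqn_mod_dvd ?leq_double // -doubleB -muln2.
rewrite Gauss_dvdl ?coprimen2 // => /dvdn_leq H.
have tX := ltn_ord t; lia.
Qed.

(* Since N is odd, the path l, l + 2, l + 4, ... visits the whole cycle and
   jumps over each cell only once in its first N steps. *)
Lemma stride2_osc u (k l : I) :
  `|u k - u l| <= \sum_i `|u (ordS i) - u (ord_pred i)|.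
Proof.
have [h _ hK] := injF_bij (@iter2_ordS_inj 0 l).
have -> : k = iter ((h k).*2) (@ordS _) l by rewrite -{1}[k]hK addn0.
set m := h k.
have step n : (n <= xsize X)%N -> `|u (iter n.*2 (@ordS _) l) - u l| <=
    \sum_(t < n) `|u (ordS (iter t.*2.+1 (@ordS _) l))
                   - u (ord_pred (iter t.*2.+1 (@ordS _) l))|.
  elim: n => [|n IH] nX; first by rewrite subrr normr0 big_ord0.
  rewrite big_ord_recr /= ordSK.
  apply: le_trans (lerD (IH (ltnW nX)) (lexx _)).
  by rewrite [leRHS]addrC ler_distD.
apply: le_trans (step _ (ltnW (ltn_ord m))) _.
rewrite [leRHS](reindex_inj (@iter2_ordS_inj 1 l)) /=.
rewrite (big_ord_widen _ (fun t => `|u (ordS (iter t.*2.+1 (@ordS _) l))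
  - u (ord_pred (iter t.*2.+1 (@ordS _) l))|) (ltnW (ltn_ord m))).
rewrite [leRHS](bigID (fun t : I => (t < m)%N)) /=.
under [X in _ <= X + _]eq_bigr => t _ do rewrite addn1.
by rewrite lerDl sumr_ge0.
Qed.

(** A mean-zero array is bounded by its oscillation, hence by [g], twice the integral of
    [|cdiff u|]. The torus has length 1, so Cauchy-Schwarz bounds [g ^+ 2] by 4 times the squared
    norm. *)
Lemma poincare_cdiff u : mean u = 0 -> ip u u <= 4 * ip (cdiff u) (cdiff u).
Proof.
move=> u0; pose g := \sum_i `|u (ordS i) - u (ord_pred i)|.
have gE : g = 2 * \sum_i dx i * (`|cdiff u i| * 1).
  rewrite mulr_sumr; apply: eq_bigr => i _.
  rewrite mulr1 -{1}(gtr0_norm (dx_gt0 i)) -normrM dx_cdiff normrM.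
  by rewrite [`|2^-1|]gtr0_norm ?invr_gt0 //; lra.
have ug i : `|u i| <= g.
  have -> : u i = \sum_k dx k * (u i - u k).
    under eq_bigr => k _ do rewrite mulrBr.
    by rewrite sumrB -mulr_suml dx_sum mul1r -/(mean u) u0 subr0.
  apply: le_trans (ler_norm_sum _ _ _) _.
  rewrite -[leRHS]mul1r -(dx_sum X) mulr_suml; apply: ler_sum => k _.
  by rewrite normrM gtr0_norm ?dx_gt0 // ler_pM2l ?dx_gt0 // stride2_osc.
have g0 : 0 <= g by apply: sumr_ge0.
have : ip u u <= g ^+ 2.
  rewrite -[leRHS]mul1r -(dx_sum X) mulr_suml; apply: ler_sum => i _.
  rewrite ler_pM2l ?dx_gt0 // -expr2 -[u i ^+ 2]real_normK ?num_real //.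
  by rewrite ler_sqr ?nnegrE.
move=> H; apply: (le_trans H); rewrite gE exprMn.
have := @cauchy_schwarz_weighted R I (@dx R X) (fun i => `|cdiff u i|) (fun=> 1)
  (fun i => ltW (dx_gt0 i)).
under [X in _ <= X * _ -> _]eq_bigr => i _ do
  rewrite real_normK ?num_real // expr2.
under [X in _ <= _ * X -> _]eq_bigr => i _ do rewrite expr1n mulr1.
rewrite dx_sum mulr1 -/(ip (cdiff u) (cdiff u)).
lra.
Qed.

Lemma cdiff_inj u w : mean u = mean w -> cdiff u =1 cdiff w -> u =1 w.
Proof.
move=> m d i; pose e i := u i + - 1 * w i.
have e0 : ip e e = 0.
  apply: le_anti; rewrite ip_ge0 andbT.
  have -> : 0 = 4 * ip (cdiff e) (cdiff e).
    by rewrite /ip big1 ?mulr0 // => k _; rewrite cdiff_comb d; ring.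
  by apply: poincare_cdiff; rewrite mean_comb m; ring.
move/psumr_eq0P: e0 => /(_ _ i isT).
have H k : 0 <= dx k * (e k * e k).
  by rewrite mulr_ge0 ?(ltW (dx_gt0 k)) // -expr2 sqr_ge0.
move=> /(_ (fun k _ => H k)) /eqP.
rewrite mulf_eq0 gt_eqF ?dx_gt0 //= -expr2 sqrf_eq0 /e mulN1r subr_eq0.
by move/eqP.
Qed.

(** [T = cdiff + mean] is injective in finite dimension, hence onto. It preserves the mean, so the
    preimage of a mean-zero array has mean zero, and there [T] reduces to [cdiff]. *)
Lemma cdiff_surj u : mean u = 0 -> exists w, mean w = 0 /\ cdiff w =1 u.
Proof.
move=> u0.
pose T (w : I -> R) i := cdiff w i + mean w.
pose A : 'M[R]_(xsize X) := \matrix_(k, i) T (fun l => (l == k)%:R) i.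
have TE (v : 'rV_(xsize X)) i : (v *m A) 0 i = T (v 0) i.
  rewrite mxE; under eq_bigr => k _ do rewrite mxE /T mulrDr.
  have vE l : \sum_k v 0 k * (l == k)%:R = v 0 l.
    rewrite (bigD1 l) //= eqxx mulr1 big1 ?addr0 // => k /negPf kn.
    by rewrite eq_sym kn mulr0.
  rewrite big_split /= -cdiff_sum /cdiff !vE; congr (_ + _).
  under eq_bigr => k _ do rewrite /mean mulr_sumr.
  rewrite exchange_big; apply: eq_bigr => l _ /=.
  by rewrite -[in RHS]vE mulr_sumr; apply: eq_bigr => k _; rewrite mulrCA.
have Tmean w : mean (T w) = mean w.
  rewrite {1}/mean; under eq_bigr => i _ do rewrite mulrDr.
  by rewrite big_split /= -/(mean _) mean_cdiff add0r -/(mean _) mean_const.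
have Au : A \in unitmx.
  rewrite -row_free_unit; apply: inj_row_free => v vA; apply/rowP => i.
  have Tv k : T (v 0) k = 0 by rewrite -TE vA mxE.
  have mv : mean (v 0) = 0.
    by rewrite -Tmean /mean big1 // => k _; rewrite Tv mulr0.
  rewrite mxE; apply: (@cdiff_inj (v 0) (fun=> 0)).
    by rewrite mean_const.
  by move=> k; have := Tv k; rewrite /T mv addr0 => ->;
    rewrite /cdiff subrr mul0r.
pose w := \row_i u i *m invmx A.
have Tw i : T (w 0) i = u i by rewrite -TE /w mulmxKV // mxE.
have mw : mean (w 0) = 0.
  by rewrite -Tmean -u0; apply: eq_bigr => i _; rewrite Tw.
by exists (w 0); split=> // i; rewrite -Tw /T mw addr0.
Qed.

End OddSize.
End Torus.

(** * Moment equations *)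

Section Kinetic.
Variables (R : realType) (X : space_mesh R) (K : finType) (v M dv : K -> R).
Local Notation I := 'I_(xsize X).
Implicit Types f g : I -> K -> R.

Definition vmom (c : K -> R) f (i : I) : R := \sum_k c k * dv k * f i k.

Definition dens := vmom (fun=> 1).
Definition cur := vmom v.

Definition micro f (i : I) (k : K) : R := f i k - dens f i * M k.

(** Written in the shape of [norm2g], so that [dist_eq] unfolds to its square root. *)
Definition wnorm2 f : R :=
  \sum_i \sum_k `|f i k| ^+ 2 * (M k)^-1 * dx i * dv k.

(* [C] is the collision term of the scheme, and [v * dv * (dx * cdiff g)] the
   difference of the transport fluxes. *)
Definition kstep (eps dt : R) (C : I -> K -> R) f g : Prop :=
  forall i k, eps * dx i * dv k * (g i k - f i k)
    + dt * (v k * dv k * (dx i * cdiff (g^~ k) i)) = dt / eps * C i k.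

(** [C] carries the weights dx_i dv_k, whence the factors [dx i]. The clauses are mass conservation,
    damping of the current at rate 1, and dissipation of the kinetic part. *)
Definition collision_spec (C : I -> K -> R) g : Prop :=
  [/\ forall i, \sum_k C i k = 0,
      forall i, \sum_k v k * C i k = - (dx i * cur g i)
    & forall i, \sum_k C i k * (g i k / M k)
        <= - (dx i * \sum_k dv k * (micro g i k ^+ 2 / M k))].

Definition mom2 : R := \sum_k v k ^+ 2 * M k * dv k.
Definition mom4 : R := \sum_k v k ^+ 4 * M k * dv k.

Hypothesis M_gt0 : forall k, 0 < M k.
Hypothesis dv_gt0 : forall k, 0 < dv k.
Hypothesis M_sum : \sum_k M k * dv k = 1.
Hypothesis M_mean : \sum_k v k * M k * dv k = 0.

Lemma wnorm2E f : wnorm2 f = \sum_i dx i * \sum_k dv k * (f i k ^+ 2 / M k).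
Proof.
apply: eq_bigr => i _; rewrite mulr_sumr; apply: eq_bigr => k _.
by rewrite real_normK ?num_real //; ring.
Qed.

Lemma wnorm2_ge0 f : 0 <= wnorm2 f.
Proof.
rewrite wnorm2E; apply: sumr_ge0 => i _.
apply: mulr_ge0; first exact/ltW/dx_gt0.
apply: sumr_ge0 => k _; apply: mulr_ge0; first exact/ltW/dv_gt0.
by rewrite divr_ge0 ?sqr_ge0 // ltW.
Qed.

Lemma vmom_micro c f i :
  vmom c f i = (\sum_k c k * M k * dv k) * dens f i + vmom c (micro f) i.
Proof.
by rewrite mulr_suml -big_split; apply: eq_bigr => k _ /=; rewrite /micro; ring.
Qed.

Lemma cur_micro f i : cur f i = vmom v (micro f) i.
Proof. by rewrite /cur vmom_micro M_mean mul0r add0r. Qed.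

Lemma dens_micro f i : dens (micro f) i = 0.
Proof.
have := vmom_micro (fun=> 1) f i; rewrite -!/dens.
under eq_bigr => k _ do rewrite mul1r.
by rewrite M_sum mul1r; lra.
Qed.

(** Cauchy-Schwarz in velocity with weights M dv, applied to [c] and [f / M]. *)
Lemma vmom_sqr_le c f :
  ip (vmom c f) (vmom c f) <= (\sum_k c k ^+ 2 * M k * dv k) * wnorm2 f.
Proof.
rewrite wnorm2E mulr_sumr; apply: ler_sum => i _.
rewrite [leRHS]mulrCA ler_pM2l ?dx_gt0 // -expr2.
have := @cauchy_schwarz_weighted R K (fun k => M k * dv k) c
  (fun k => f i k / M k).
move=> /(_ (fun k => ltW (mulr_gt0 (M_gt0 k) (dv_gt0 k)))).
congr (_ ^+ 2 <= _ * _); apply: eq_bigr => k _; try (by ring);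
  by field; rewrite gt_eqF.
Qed.

(** Pythagoras: [micro f] has zero density, hence is orthogonal to [dens f * M], and M has unit
    norm. *)
Lemma wnorm2_split f : wnorm2 f = ip (dens f) (dens f) + wnorm2 (micro f).
Proof.
rewrite !wnorm2E -big_split; apply: eq_bigr => i _ /=.
rewrite -mulrDr; congr (_ * _).
have -> : \sum_k dv k * (f i k ^+ 2 / M k) =
    \sum_k (dens f i ^+ 2 * (M k * dv k)
            + 2 * dens f i * (1 * dv k * micro f i k)
            + dv k * (micro f i k ^+ 2 / M k)).
  by apply: eq_bigr => k _; rewrite /micro; field; rewrite gt_eqF.
rewrite !big_split /= -!mulr_sumr M_sum -/(vmom (fun=> 1) (micro f) i).
by rewrite -/dens dens_micro; ring.
Qed.

Lemma micro_le f : wnorm2 (micro f) <= wnorm2 f.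
Proof. by rewrite (wnorm2_split f) lerDr ip_ge0. Qed.

(** * Balance laws over one implicit time step *)

Section Step.
Variables (eps dt : R) (C : I -> K -> R) (f g : I -> K -> R).
Hypotheses (eps_gt0 : 0 < eps) (dt_gt0 : 0 < dt).
Hypotheses (Hstep : kstep eps dt C f g) (HC : collision_spec C g).

(** The scheme summed against [c]; transport raises the moment from [c] to [c * v]. The choices 1
    and [v] give the mass and momentum balances. *)
Lemma vmom_step c i :
  dx i * (eps * (vmom c g i - vmom c f i)
          + dt * cdiff (vmom (fun k => c k * v k) g) i)
  = dt / eps * \sum_k c k * C i k.
Proof.
rewrite /vmom cdiff_sum -sumrB !mulr_sumr -big_split mulr_sumr.
apply: eq_bigr => k _ /=.
by rewrite [RHS]mulrCA -Hstep; ring.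
Qed.

Lemma dens_step i : dens g i = dens f i + - (dt / eps) * cdiff (cur g) i.
Proof.
have [C0 _ _] := HC.
have := vmom_step (fun=> 1) i.
under [X in _ = _ * X]eq_bigr => k _ do rewrite mul1r.
rewrite C0 mulr0 => /eqP; rewrite mulf_eq0 gt_eqF ?dx_gt0 //= => /eqP.
have -> : cdiff (vmom (fun k => 1 * v k) g) i = cdiff (cur g) i.
  by rewrite /cdiff; congr ((_ - _) / _); apply: eq_bigr => k _; rewrite mul1r.
rewrite -/dens => E.
apply: (mulfI (lt0r_neq0 eps_gt0)); apply/eqP; rewrite -subr_eq0 -E; apply/eqP.
by field; rewrite gt_eqF.
Qed.

Lemma cur_step i :
  eps * (cur g i - cur f i)
  = - dt * cdiff (vmom (fun k => v k ^+ 2) g) i - dt / eps * cur g i.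
Proof.
have [_ C1 _] := HC.
have := vmom_step v i; rewrite C1 -/cur.
have -> : cdiff (vmom (fun k => v k * v k) g) i =
    cdiff (vmom (fun k => v k ^+ 2) g) i.
  by rewrite /cdiff; congr ((_ - _) / _); apply: eq_bigr => k _; rewrite expr2.
have -> : dt / eps * - (dx i * cur g i) = dx i * (- (dt / eps) * cur g i).
  by ring.
move=> /(mulfI (lt0r_neq0 (dx_gt0 i))); lra.
Qed.

(** Test with [g / M]: transport cancels for each velocity by skew-symmetry, and 2 (g - f) g = g^2 -
    f^2 + (g - f)^2. The squared increment is kept to absorb a time-discretization error later. *)
Lemma energy_step :
  wnorm2 g - wnorm2 f + wnorm2 (fun i k => g i k - f i k)
    <= - (2 * dt / eps ^+ 2) * wnorm2 (micro g).
Proof.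
have [_ _ C2] := HC.
have -> : wnorm2 g - wnorm2 f + wnorm2 (fun i k => g i k - f i k) =
    2 * (\sum_i \sum_k dx i * dv k * (g i k - f i k) * (g i k / M k)).
  rewrite !wnorm2E -sumrB -big_split mulr_sumr; apply: eq_bigr => i _ /=.
  rewrite -mulrBr -mulrDr -sumrB -big_split !mulr_sumr.
  by apply: eq_bigr => k _ /=; ring.
have -> : \sum_i \sum_k dx i * dv k * (g i k - f i k) * (g i k / M k) =
    dt / eps ^+ 2 * (\sum_i \sum_k C i k * (g i k / M k))
    - dt / eps * (\sum_i \sum_k v k * dv k / M k
                    * (dx i * (cdiff (g^~ k) i * g i k))).
  rewrite !mulr_sumr -sumrB; apply: eq_bigr => i _.
  rewrite !mulr_sumr -sumrB; apply: eq_bigr => k _.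
  have -> : dt / eps ^+ 2 * (C i k * (g i k / M k)) =
      (dt / eps * C i k) * (g i k / M k) / eps by field; rewrite !gt_eqF.
  by rewrite -Hstep; field; rewrite !gt_eqF.
rewrite [X in _ - _ * X]exchange_big [X in _ - _ * X]big1 => [|k _]; last first.
  have sk : ip (cdiff (g^~ k)) (g^~ k) = 0.
    by have := ip_cdiff (g^~ k) (g^~ k); rewrite [in X in _ = X]ipC; lra.
  by rewrite -mulr_sumr -/(ip (cdiff (g^~ k)) (g^~ k)) sk mulr0.
rewrite mulr0 subr0 wnorm2E.
pose D i := dx i * \sum_k dv k * (micro g i k ^+ 2 / M k).
have -> : - (2 * dt / eps ^+ 2) * (\sum_i D i) =
    2 * (dt / eps ^+ 2 * \sum_i - D i).
  by rewrite sumrN; ring.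
rewrite ler_pM2l // ler_pM2l ?divr_gt0 ?exprn_gt0 //.
by apply: ler_sum => i _.
Qed.

End Step.

End Kinetic.

(** * Lyapunov functional *)

Section Lyapunov.
Variables (R : realType) (X : space_mesh R) (K : finType) (v M dv : K -> R).
Local Notation I := 'I_(xsize X).
Local Notation dens := (@dens R X K dv).
Local Notation cur := (@cur R X K v dv).
Local Notation wnorm2 := (@wnorm2 R X K M dv).
Local Notation micro := (@micro R X K M dv).
Local Notation m2 := (mom2 v M dv).
Hypothesis M_gt0 : forall k, 0 < M k.
Hypothesis dv_gt0 : forall k, 0 < dv k.
Hypothesis M_sum : \sum_k M k * dv k = 1.
Hypothesis M_mean : \sum_k v k * M k * dv k = 0.
Hypothesis oddX : odd (xsize X).

(** [w] stands for the mean-zero solution of [cdiff w = dens f]; passing it as an argument avoids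
    choosing an inverse of [cdiff]. *)
Definition lyapunov (eta eps : R) (f : I -> K -> R) (w : I -> R) : R :=
  wnorm2 f / 2 - eta * eps * ip (cur f) w.

(** Only the kinetic part carries a current, the Maxwellian having zero mean velocity. *)
Lemma cur_sqr_le f : ip (cur f) (cur f) <= m2 * wnorm2 (micro f).
Proof.
rewrite (@eq_ip _ _ _ (vmom dv v (micro f)) _ (vmom dv v (micro f)));
  try by move=> i; rewrite (cur_micro M_mean).
exact: vmom_sqr_le.
Qed.

Lemma antideriv_sqr_le f w : mean w = 0 -> cdiff w =1 dens f ->
  ip w w <= 4 * ip (dens f) (dens f).
Proof. by move=> w0 wf; rewrite -(eq_ip wf wf); apply: poincare_cdiff. Qed.

(** By Young and [ip w w <= 4 * P], the correction is at most [eta * (m2 * h / 2 + 2 * P)], which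
    the conditions on [eta] bring below [(h + P) / 4]. *)
Lemma lyapunov_equiv eta eps f w :
  0 < eta -> 8 * eta <= 1 -> eta * m2 <= 4^-1 -> 0 < eps < 1 ->
  mean w = 0 -> cdiff w =1 dens f ->
  wnorm2 f / 4 <= lyapunov eta eps f w <= wnorm2 f.
Proof.
move=> eta0 eta8 etam2 /andP[eps0 eps1] w0 wf.
have cf := cur_sqr_le f; have wP := antideriv_sqr_le w0 wf.
have H1 := ip_young (cur f) w ltr01; have H2 := ip_youngN (cur f) w ltr01.
rewrite invr1 !mul1r in H1 H2.
have P0 := ip_ge0 (dens f); have h0 := wnorm2_ge0 M_gt0 dv_gt0 (micro f).
have fE := wnorm2_split M_gt0 M_sum f; rewrite /lyapunov fE.
move: P0 h0 cf wP H1 H2.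
set P := ip (dens f) _; set h := wnorm2 _; set z := ip (cur f) w.
move=> P0 h0 cf wP H1 H2.
have bz : `|z| <= m2 * h / 2 + 2 * P.
  by rewrite ler_norml; apply/andP; split; lra.
have : `|eta * eps * z| <= (h + P) / 4.
  rewrite !normrM (gtr0_norm eta0) (gtr0_norm eps0).
  have : eta * (eps * `|z|) <= eta * (1 * (m2 * h / 2 + 2 * P)).
    by rewrite ler_pM2l // ler_pM // ltW.
  have : eta * m2 * h <= 4^-1 * h by rewrite ler_wpM2r.
  have : 8 * eta * P <= 1 * P by rewrite ler_wpM2r.
  lra.
by rewrite ler_norml => /andP[? ?]; apply/andP; split; lra.
Qed.

(** * Decrease of the functional over one time step *)

Section Step.
Variables (m2lo m2hi m4hi dtmax eta : R).
Hypothesis m2lo_gt0 : 0 < m2lo.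
Hypothesis m2_bounds : m2lo <= m2 <= m2hi.
Hypothesis m4_le : mom4 v M dv <= m4hi.
Hypothesis eta_gt0 : 0 < eta.
Hypothesis eta_le8 : 8 * eta <= 1.
Hypothesis eta_le : eta * (m4hi / m2lo + 4 * m2hi / m2lo + m2hi) <= 4^-1.
Hypothesis eta_dt : eta * (dtmax * m2hi ^+ 2) <= 2^-1.

Variables (eps dt : R) (C : I -> K -> R) (f g : I -> K -> R) (w w' : I -> R).
Hypotheses (eps_bd : 0 < eps < 1) (dt_bd : 0 < dt <= dtmax).
Hypotheses (Hstep : kstep v dv eps dt C f g) (HC : collision_spec v M dv C g).
Hypotheses (w_mean : mean w = 0) (wE : cdiff w =1 dens f).
Hypotheses (w'_mean : mean w' = 0) (w'E : cdiff w' =1 dens g).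

Let eps0 : 0 < eps. Proof. by case/andP: eps_bd. Qed.
Let dt0 : 0 < dt. Proof. by case/andP: dt_bd. Qed.
Let J0 i := cur g i + - mean (cur g) * 1.
Let S := vmom dv (fun k => v k ^+ 2) (micro g).

(** By the mass balance both sides have the same [cdiff]; centering the current into [J0] gives both
    mean zero, so injectivity applies. *)
Lemma antideriv_step i : w' i = w i + - (dt / eps) * J0 i.
Proof.
apply: (cdiff_inj oddX (w := fun i => w i + - (dt / eps) * J0 i)) => [|k].
  by rewrite mean_comb /J0 mean_comb mean_const w_mean w'_mean; ring.
rewrite w'E cdiff_comb wE (dens_step eps0 Hstep HC) /J0 cdiff_comb.
by rewrite {3}/cdiff subrr mul0r mulr0 addr0.
Qed.

(** Test the momentum balance against [w']. Skew-symmetry moves [cdiff] onto [w'], turning it into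
    the density and producing the missing dissipation; the [J0] terms come from the change of
    [w]. *)
Lemma cross_term_step :
  eps * ip (cur g) w' - eps * ip (cur f) w =
    dt * (m2 * ip (dens g) (dens g) + ip (dens g) S)
    - dt / eps * ip (cur g) w'
    - dt * (ip (cur g) J0 - ip (fun i => cur g i + -1 * cur f i) J0).
Proof.
pose T := vmom dv (fun k => v k ^+ 2) g.
have Tw : ip (cdiff T) w' = - (m2 * ip (dens g) (dens g) + ip (dens g) S).
  rewrite ip_cdiff (eq_ip (fun=> erefl) w'E) (ipC T); congr (- _).
  rewrite addrC -ip_combr; apply: eq_ip => // i.
  by rewrite /T (vmom_micro M) addrC.
have H1 : ip (fun i => (- dt * cdiff T i) + - (dt / eps) * cur g i) w' =
    eps * ip (fun i => cur g i + -1 * cur f i) w'.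
  rewrite /ip mulr_sumr; apply: eq_bigr => i _.
  have := cur_step Hstep HC i; rewrite -/T => E.
  have -> : - dt * cdiff T i + - (dt / eps) * cur g i =
    - dt * cdiff T i - dt / eps * cur g i by ring.
  by rewrite -E; ring.
have zT : ip (fun i => - dt * cdiff T i) w' = - dt * ip (cdiff T) w'.
  by rewrite /ip mulr_sumr; apply: eq_bigr => i _; ring.
rewrite ip_combl zT Tw ip_combl in H1.
have H2 : ip (cur f) w' = ip (cur f) w + - (dt / eps) * ip (cur f) J0.
  by rewrite -ip_combr; apply: eq_ip => // i; rewrite antideriv_step.
rewrite ip_combl.
have e1 : eps * (dt / eps) = dt by rewrite mulrC divfK ?gt_eqF.
have : eps * ip (cur f) w' = eps * ip (cur f) w - dt * ip (cur f) J0.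
  by rewrite H2 -[in RHS]e1; ring.
move: H1; lra.
Qed.

Lemma lyapunov_step :
  (1 + eta * m2lo / 2 * dt) * lyapunov eta eps g w' <= lyapunov eta eps f w.
Proof.
have Pge0 := ip_ge0 (dens g).
have h_ge0 := wnorm2_ge0 M_gt0 dv_gt0 (micro g).
have lo_gt0 := m2lo_gt0; have [m2_lo m2_hi] := andP m2_bounds.
have [_ dt_max] := andP dt_bd; have [_ eps1] := andP eps_bd.
have m2_gt0 : 0 < m2 := lt_le_trans m2lo_gt0 m2_lo.
have jj := cur_sqr_le g.
have J0J0 : ip J0 J0 <= m2 * wnorm2 (micro g).
  exact: le_trans (ip_center_le _) jj.
(* The fourth moment of M controls [S]. The Young weight m2lo / 2 costs a quarter of [m2lo * P],
   with P the squared norm of the density. *)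
have Hs : - ip (dens g) S <=
    m2lo / 4 * ip (dens g) (dens g) + m4hi / m2lo * wnorm2 (micro g).
  have c0 : 0 < m2lo / 2 by lra.
  have := ip_youngN (dens g) S c0; rewrite invf_div.
  have SS : ip S S <= m4hi * wnorm2 (micro g).
    apply: le_trans (vmom_sqr_le M_gt0 dv_gt0 _ _) _.
    rewrite ler_wpM2r //; apply: le_trans m4_le.
    by apply: ler_sum => k _; rewrite -exprM.
  have : 2 / m2lo * ip S S <= 2 / m2lo * (m4hi * wnorm2 (micro g)).
    by rewrite ler_wpM2l // divr_ge0 // ltW.
  lra.
(* The weight eps m2lo / 8 offsets the Poincare factor 4: again a quarter of [m2lo * P] is spent,
   and the singular factor falls on h / eps^2, which the energy dissipates. *)
have Hy : ip (cur g) w' / eps <= m2lo / 4 * ip (dens g) (dens g)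
    + 4 * m2hi / m2lo * (wnorm2 (micro g) / eps ^+ 2).
  have c0 : 0 < eps * m2lo / 8 by rewrite divr_gt0 ?mulr_gt0.
  have Y := ip_young w' (cur g) c0.
  have WW := antideriv_sqr_le w'_mean w'E.
  have B1 : eps * m2lo / 8 * ip w' w' <=
      eps * m2lo / 8 * (4 * ip (dens g) (dens g)) by rewrite ler_pM2l.
  have B2 : (eps * m2lo / 8)^-1 * ip (cur g) (cur g) <=
      (eps * m2lo / 8)^-1 * (m2hi * wnorm2 (micro g)).
    rewrite ler_pM2l ?invr_gt0 //; apply: le_trans jj _.
    by rewrite ler_wpM2r.
  rewrite ler_pdivrMr // ipC.
  have -> : (m2lo / 4 * ip (dens g) (dens g)
      + 4 * m2hi / m2lo * (wnorm2 (micro g) / eps ^+ 2)) * eps =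
    (eps * m2lo / 8 * (4 * ip (dens g) (dens g))
     + (eps * m2lo / 8)^-1 * (m2hi * wnorm2 (micro g))) / 2.
    by field; rewrite !gt_eqF.
  lra.
have Hz1 : ip (cur g) J0 <= m2hi * wnorm2 (micro g).
  have := ip_young (cur g) J0 ltr01.
  have : m2 * wnorm2 (micro g) <= m2hi * wnorm2 (micro g) by rewrite ler_wpM2r.
  rewrite invr1; lra.
pose delta i k := g i k - f i k.
(* The Young weight gives the increment the coefficient 1/2 that the energy step provides. The rest
   is of second order in dt and is controlled through dtmax by [eta_dt]. *)
have Hz2 : - (eta * dt * ip (fun i => cur g i + -1 * cur f i) J0) <=
    wnorm2 delta / 2 + dt / 4 * wnorm2 (micro g).
  have dE i : cur g i + -1 * cur f i = cur delta i.
    rewrite mulN1r -sumrB; apply: eq_bigr => k _; rewrite /delta; ring.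
  rewrite (eq_ip dE (fun=> erefl)).
  have c0 : 0 < (eta * dt * m2)^-1 by rewrite invr_gt0 !mulr_gt0.
  have := ip_youngN (cur delta) J0 c0; rewrite invrK => Y.
  have DD : ip (cur delta) (cur delta) <= m2 * wnorm2 delta.
    apply: le_trans (cur_sqr_le _) _.
    by rewrite ler_pM2l // micro_le.
  have B1 : (eta * dt * m2)^-1 * ip (cur delta) (cur delta) <=
      (eta * dt * m2)^-1 * (m2 * wnorm2 delta) by rewrite ler_pM2l.
  have B2 : eta * dt * m2 * ip J0 J0 <=
      eta * dt * m2 * (m2 * wnorm2 (micro g)) by rewrite ler_pM2l ?mulr_gt0.
  have B3 : eta * dt * (- (2 * ip (cur delta) J0)) <= eta * dt *
    ((eta * dt * m2)^-1 * (m2 * wnorm2 delta)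
     + eta * dt * m2 * (m2 * wnorm2 (micro g))).
    by rewrite ler_pM2l ?mulr_gt0 //; lra.
  have E : eta * dt * ((eta * dt * m2)^-1 * (m2 * wnorm2 delta)
     + eta * dt * m2 * (m2 * wnorm2 (micro g))) =
     wnorm2 delta + dt * (eta * (eta * (dt * m2 ^+ 2))) * wnorm2 (micro g).
    by field; rewrite !gt_eqF.
  have B4 : eta * (eta * (dt * m2 ^+ 2)) <= 1 * 2^-1.
    have x0 : 0 <= dt * m2 ^+ 2 by rewrite pmulr_rge0 ?sqr_ge0.
    have x1 : dt * m2 ^+ 2 <= dtmax * m2hi ^+ 2.
      by rewrite ler_pM ?sqr_ge0 ?(ltW dt0) // ler_sqr ?nnegrE // ltW //
        (lt_le_trans m2_gt0).
    have e0 := eta_gt0; have e8 := eta_le8.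
    apply: ler_pM; [exact: ltW|by rewrite mulr_ge0 // ltW|by lra|].
    by apply: le_trans eta_dt; rewrite ler_pM2l.
  have B5 : dt * (eta * (eta * (dt * m2 ^+ 2))) * wnorm2 (micro g) <=
      dt * (1 * 2^-1) * wnorm2 (micro g).
    by rewrite ler_wpM2r // ler_pM2l.
  lra.
have HE := energy_step M_gt0 eps0 dt0 Hstep HC; rewrite -/delta in HE.
have FE := wnorm2_split M_gt0 M_sum g.
have X1 := cross_term_step.
have hq : wnorm2 (micro g) <= wnorm2 (micro g) / eps ^+ 2.
  by rewrite ler_pdivlMr ?exprn_gt0 // ler_piMr // exprn_ile1 // ltW.
have eq' : - (2 * dt / eps ^+ 2) * wnorm2 (micro g) =
   - (2 * dt * (wnorm2 (micro g) / eps ^+ 2)) by ring.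
have ey : dt / eps * ip (cur g) w' = dt * (ip (cur g) w' / eps) by ring.
rewrite eq' in HE; rewrite ey in X1.
have m2hi_gt0 : 0 < m2hi := lt_le_trans m2_gt0 m2_hi.
have m4hi_ge0 : 0 <= m4hi.
  apply: le_trans m4_le; apply: sumr_ge0 => k _.
  apply: mulr_ge0 (ltW (dv_gt0 k)); apply: mulr_ge0 (ltW (M_gt0 k)).
  exact: exprn_even_ge0.
have etam : eta * m2hi <= 4^-1.
  apply: le_trans eta_le; rewrite ler_pM2l //.
  by rewrite lerDr addr_ge0 ?divr_ge0 ?mulr_ge0 ?(ltW m2lo_gt0) // ltW.
have etam2 : eta * m2 <= 4^-1.
  by apply: le_trans etam; rewrite ler_pM2l.
have /andP[_ L'] := lyapunov_equiv eta_gt0 eta_le8 etam2 eps_bd w'_mean w'E.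
have eta_lo : eta * m2lo <= 4^-1.
  by apply: le_trans etam2; rewrite ler_pM2l.
move: L' HE FE X1 hq Hs Hy Hz1 Hz2 Pge0 h_ge0; rewrite /lyapunov.
set P := ip (dens g) _; set h := wnorm2 (micro g); set q := h / eps ^+ 2.
set F' := wnorm2 g; set F := wnorm2 f; set d := wnorm2 delta.
set A' := ip (cur g) w'; set A := ip (cur f) w; set y := A' / eps.
set s := ip (dens g) S; set z1 := ip (cur g) J0; set z2 := ip _ J0.
move=> L' HE FE X1 hq Hs Hy Hz1 Hz2 P_ge0 h_ge0.
set H := F' / 2 - eta * eps * A' in L' *.
have B1 : eta * dt * (- s + y + z1) <= eta * dt * (m2lo / 2 * P
    + (m4hi / m2lo + m2hi) * h + 4 * m2hi / m2lo * q).
  by rewrite ler_pM2l ?mulr_gt0 //; lra.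
have B2 : eta * dt * ((m4hi / m2lo + m2hi) * h) <=
    eta * dt * ((m4hi / m2lo + m2hi) * q).
  rewrite ler_pM2l ?mulr_gt0 // ler_wpM2l // addr_ge0 ?divr_ge0 //; exact: ltW.
have q_ge0 : 0 <= q by lra.
have B3 : dt * q * (eta * (m4hi / m2lo + 4 * m2hi / m2lo + m2hi))
    <= dt * q * 4^-1.
  by rewrite ler_wpM2l // mulr_ge0 // ltW.
have B4 : eta * dt * (m2lo * P) <= eta * dt * (m2 * P).
  by rewrite ler_pM2l ?mulr_gt0 // ler_wpM2r.
have B5 : dt * h <= dt * q by rewrite ler_pM2l.
(* The gain is measured with [H <= P + h]; its share of P is the half of [m2lo * P] left over by
   [Hs] and [Hy]. *)
have B6 : eta * m2lo / 2 * dt * H <= eta * m2lo / 2 * dt * (P + h).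
  by rewrite ler_wpM2l ?L' -?FE // !mulr_ge0 ?invr_ge0 // ltW.
have B7 : eta * m2lo * (dt * h) <= 4^-1 * (dt * h).
  by rewrite ler_wpM2r // mulr_ge0 // ltW.
have X2 : eta * (eps * A' - eps * A) =
    eta * (dt * (m2 * P + s) - dt * y - dt * (z1 - z2)).
  by rewrite X1.
have dt_ge0 := ltW dt0.
have B8 : 0 <= dt * h by rewrite mulr_ge0.
rewrite mulrDl mul1r.
have -> : F / 2 - eta * eps * A = H + (F - F') / 2 + eta * (eps * A' - eps * A).
  by rewrite /H; ring.
(* Of the kinetic dissipation [dt * q], the remainders use at most 1/4 ([B3]), 1/4 ([Hz2]) and 1/8
   ([B7]). *)
rewrite X2; lra.
Qed.

End Step.
End Lyapunov.

(** * Decay for an abstract collision operator *)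

(** Use 1 + z <= exp z with z = - c x / (1 + c x); replacing x by y in the denominator makes the
    rate uniform over time steps up to y. *)
Lemma invr1D_le_expR (R : realType) (x y : R) :
  0 <= x <= y -> forall c : R, 0 < c ->
  (1 + c * x)^-1 <= expR (- (c / (1 + c * y)) * x).
Proof.
move=> /andP[x0 xy] c c0.
have cx : 0 <= c * x by rewrite mulr_ge0 // ltW.
have cy : c * x <= c * y by rewrite ler_pM2l.
have p1 : 0 < 1 + c * x by lra.
have p2 : 0 < 1 + c * y by lra.
have -> : (1 + c * x)^-1 = 1 + - (c * x / (1 + c * x)).
  by field; rewrite gt_eqF.
apply: le_trans (expR_ge1Dx _) _.
rewrite ler_expR.
have -> : - (c / (1 + c * y)) * x = - (c * x / (1 + c * y)) by ring.
by rewrite lerN2 ler_wpM2l // lef_pV2 ?posrE //; lra.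
Qed.

Section Decay.
Variable R : realType.

Lemma mean_dens_step (X : space_mesh R) (K : finType) (v M dv : K -> R)
    (eps dt : R) (C f g : 'I_(xsize X) -> K -> R) :
  0 < eps -> kstep v dv eps dt C f g -> collision_spec v M dv C g ->
  mean (dens dv g) = mean (dens dv f).
Proof.
move=> eps0 Hs HC; rewrite -[RHS]addr0 -(mulr0 (- (dt / eps))).
rewrite -(mean_cdiff (cur v dv g)) -mean_comb.
by apply: eq_bigr => i _; rewrite (dens_step eps0 Hs HC).
Qed.

(** [beta] is chosen before the mesh, the Maxwellian and eps. The factor 4 is the ratio of the
    equivalence constants 1 and 1/4. *)
Lemma hypocoercive_decay (m2lo m2hi m4hi dtmax : R) :
  0 < m2lo -> m2lo <= m2hi -> 0 < dtmax ->
  exists2 beta : R, 0 < beta &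
  forall (X : space_mesh R) (K : finType) (v M dv : K -> R),
    odd (xsize X) ->
    (forall k, 0 < M k) -> (forall k, 0 < dv k) ->
    \sum_k M k * dv k = 1 -> \sum_k v k * M k * dv k = 0 ->
    m2lo <= mom2 v M dv <= m2hi -> mom4 v M dv <= m4hi ->
  forall (eps dt : R) (f C : nat -> 'I_(xsize X) -> K -> R),
    0 < eps < 1 -> 0 < dt <= dtmax ->
    (forall n, kstep v dv eps dt (C n) (f n) (f n.+1)) ->
    (forall n, collision_spec v M dv (C n) (f n.+1)) ->
    mean (dens dv (f 0%N)) = 0 ->
  forall n, wnorm2 M dv (f n)
    <= 4 * wnorm2 M dv (f 0%N) * expR (- beta * (n%:R * dt)).
Proof.
move=> lo0 lohi dtmax0; have hi0 : 0 < m2hi by lra.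
pose B := `|m4hi| / m2lo + 4 * m2hi / m2lo + m2hi.
have B0 : 0 < B.
  by rewrite ltr_wpDl // addr_ge0 ?divr_ge0 ?mulr_ge0 // ltW.
pose Q := dtmax * m2hi ^+ 2; have Q0 : 0 < Q by rewrite mulr_gt0 ?exprn_gt0.
(* The summands are positive and their sum times [eta] is 1, so all three smallness conditions hold
   at once. *)
pose eta := (8 + 4 * B + 2 * Q)^-1.
have D0 : 0 < 8 + 4 * B + 2 * Q by lra.
have eta0 : 0 < eta by rewrite invr_gt0.
have etaD : eta * (8 + 4 * B + 2 * Q) = 1 by rewrite mulVf ?gt_eqF.
have eB : 0 <= eta * B by rewrite mulr_ge0 // ltW.
have eQ : 0 <= eta * Q by rewrite mulr_ge0 // ltW.
pose kappa := eta * m2lo / 2.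
have kappa0 : 0 < kappa by rewrite divr_gt0 ?mulr_gt0.
exists (kappa / (1 + kappa * dtmax)) => [|X K v M dv oddX M0 dv0 M1 Mv m2b m4b
    eps dt f C epsb dtb Hs HC f0 n].
  by rewrite divr_gt0 // ltr_pwDl // mulr_ge0 // ltW.
set beta := kappa / _.
have [eps0 _] := andP epsb; have [dt0 dtm] := andP dtb.
have mean0 m : mean (dens dv (f m)) = 0.
  by elim: m => // m IH; rewrite (mean_dens_step eps0 (Hs m) (HC m)).
have e8 : 8 * eta <= 1 by lra.
have e1 : eta * B <= 4^-1 by lra.
have e2 : eta * Q <= 2^-1 by lra.
have e3 : eta * mom2 v M dv <= 4^-1.
  apply: le_trans e1; rewrite ler_pM2l //.
  have [_ h] := andP m2b; apply: le_trans h _.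
  by rewrite lerDr addr_ge0 ?divr_ge0 ?mulr_ge0 // ltW.
have m4b' : mom4 v M dv <= `|m4hi| := le_trans m4b (ler_norm _).
(* Stated for every antiderivative [w], because the induction takes the previous one from
   [cdiff_surj]. *)
have L m w : mean w = 0 -> cdiff w =1 dens dv (f m) ->
    lyapunov v M dv eta eps (f m) w
      <= wnorm2 M dv (f 0%N) * expR (- beta * (m%:R * dt)).
  elim: m w => [|m IH] w w0 wf.
    rewrite mul0r mulr0 expR0 mulr1.
    by have /andP[] := lyapunov_equiv M0 dv0 M1 Mv oddX eta0 e8 e3 epsb w0 wf.
  have [w1 [w10 w1f]] := cdiff_surj oddX (mean0 m).
  have S := lyapunov_step M0 dv0 M1 Mv oddX lo0 m2b m4b' eta0 e8 e1 e2 epsb dtb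
    (Hs m) (HC m) w10 w1f w0 wf.
  have k1 : 0 < 1 + kappa * dt by rewrite ltr_pwDl // mulr_ge0 // ltW.
  have := le_trans S (IH w1 w10 w1f); rewrite -ler_pdivlMl // => H.
  apply: le_trans H _.
  have -> : - beta * (m.+1%:R * dt) = - beta * dt + - beta * (m%:R * dt).
    by rewrite -natr1; ring.
  rewrite expRD mulrCA ler_wpM2l ?wnorm2_ge0 // ler_pM2r ?expR_gt0 //.
  by apply: invr1D_le_expR => //; rewrite ltW.
have [w [w0 wf]] := cdiff_surj oddX (mean0 n).
have /andP[H _] := lyapunov_equiv M0 dv0 M1 Mv oddX eta0 e8 e3 epsb w0 wf.
by have := L n w w0 wf; lra.
Qed.

(** The subtracted equilibrium is constant in time and space, so it cancels in both differences. *)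
Lemma kstep_shift (X : space_mesh R) (K : finType) (v M dv : K -> R)
    (eps dt mu : R) (C f g : 'I_(xsize X) -> K -> R) :
  kstep v dv eps dt C f g ->
  kstep v dv eps dt C (fun i k => f i k - mu * M k)
    (fun i k => g i k - mu * M k).
Proof. by move=> H i k; rewrite -H /cdiff; ring. Qed.

(** Multiples of M affect neither [micro] nor the current, and they change the test function [g / M]
    by a constant, which mass conservation makes harmless. *)
Lemma collision_spec_shift (X : space_mesh R) (K : finType) (v M dv : K -> R)
    (mu : R) (C g : 'I_(xsize X) -> K -> R) :
  (forall k, 0 < M k) ->
  \sum_k M k * dv k = 1 -> \sum_k v k * M k * dv k = 0 ->
  collision_spec v M dv C g ->
  collision_spec v M dv C (fun i k => g i k - mu * M k).
Proof.
move=> M0 M1 Mv [C0 C1 C2].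
have shift c i : vmom dv c (fun i k => g i k - mu * M k) i =
    vmom dv c g i - mu * \sum_k c k * M k * dv k.
  by rewrite mulr_sumr -sumrB; apply: eq_bigr => k _; ring.
split=> [//|i|i]; first by rewrite /cur shift Mv mulr0 subr0 C1.
have E k : micro M dv (fun i k => g i k - mu * M k) i k = micro M dv g i k.
  rewrite /micro /dens shift; under eq_bigr => j _ do rewrite mul1r.
  by rewrite M1; ring.
under [X in _ <= - (_ * X)]eq_bigr => k _ do rewrite E.
have -> : \sum_k C i k * ((g i k - mu * M k) / M k) =
    \sum_k C i k * (g i k / M k) - mu * \sum_k C i k.
  by rewrite mulr_sumr -sumrB; apply: eq_bigr => k _; field; rewrite gt_eqF.
by rewrite C0 mulr0 subr0.
Qed.

End Decay.

(** Cell k lies between faces k and k + 1. Zero end fluxes allow summation by parts; for the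
    current, a second one brings back [v k * p k]. The dissipation is the Poincare inequality with
    weights [p]. *)
Lemma fokker_planck_flux_spec (R : realType) (m : nat)
    (v a p q G : nat -> R) (h : R) :
  0 < h -> (0 < m)%N ->
  (forall k, (k.+1 < m)%N -> v k < v k.+1) ->
  (forall k, (k < m)%N -> 0 <= p k) ->
  (forall k, (k < m)%N -> a k - a k.+1 = v k * p k) ->
  a 0%N = 0 -> a m = 0 -> \sum_(k < m) p k = 1 ->
  G 0%N = 0 -> G m = 0 ->
  (forall k, (k.+1 < m)%N ->
     G k.+1 = a k.+1 * (q k.+1 - q k) * (h / (v k.+1 - v k))) ->
  [/\ \sum_(k < m) (G k.+1 - G k) = 0,
      \sum_(k < m) v k * (G k.+1 - G k) = - (h * \sum_(k < m) v k * (p k * q k))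
    & \sum_(k < m) (G k.+1 - G k) * q k
      <= - (h * \sum_(k < m) p k * (q k - \sum_(j < m) p j * q j) ^+ 2)].
Proof.
case: m => // n h0 _ vincr p0 av a0 am p1 G0 Gm GE.
have parts (u : nat -> R) : \sum_(k < n.+1) u k * (G k.+1 - G k) =
    - \sum_(k < n) G k.+1 * (u k.+1 - u k).
  have := sum_by_parts n G u; rewrite G0 Gm !mul0r subr0 add0r => <-.
  by rewrite -sumrN; apply: eq_bigr => k _; ring.
split.
- under eq_bigr => k _ do rewrite -[_ - _]mul1r.
  by rewrite (parts (fun=> 1)) big1 ?oppr0 // => k _; rewrite subrr mulr0.
- rewrite parts; congr (- _).
  under [X in _ = _ * X]eq_bigr => k _ do rewrite mulrA -av //.
  rewrite sum_by_parts a0 am !mul0r subr0 add0r mulr_sumr.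
  apply: eq_bigr => k _; have vk := vincr k (ltn_ord k).
  by rewrite GE ?ltnS //; field; rewrite subr_eq0 gt_eqF.
- under eq_bigr => k _ do rewrite mulrC.
  rewrite parts lerN2.
  have -> : \sum_(k < n) G k.+1 * (q k.+1 - q k) =
      h * \sum_(k < n) a k.+1 * ((q k.+1 - q k) ^+ 2 / (v k.+1 - v k)).
    by rewrite mulr_sumr; apply: eq_bigr => k _; rewrite GE ?ltnS //; ring.
  rewrite ler_pM2l //.
  by apply: discrete_gaussian_poincare => // k kn; rewrite ?av ?p0.
Qed.

(** * Fokker-Planck and BGK schemes *)

Section VelocityMesh.
Variables (R : realType) (V : velocity_mesh R).
Local Notation L := (vsize V)%:Z.

Definition cell (k : nat) : int := k%:Z - L + 1.

Lemma inJ_cell k : (k < (vsize V).*2)%N -> inJ V (cell k).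
Proof. by rewrite /inJ /cell; lia. Qed.

Lemma sumJE (F : int -> R) : sumJ V F = \sum_(k < (vsize V).*2) F (cell k).
Proof. by []. Qed.

Lemma eq_sumJ (F G : int -> R) :
  (forall j, inJ V j -> F j = G j) -> sumJ V F = sumJ V G.
Proof. by move=> FG; apply: eq_bigr => k _; apply/FG/inJ_cell. Qed.

Lemma dv_gt0 j : inJ V j -> 0 < dv V j.
Proof. by move=> /andP[j1 j2]; rewrite subr_gt0 vface_incr //; lia. Qed.

Lemma velE j : inJ V j -> vel V j = (vface V (j - 1) + vface V j) / 2.
Proof.
move=> /andP[j1 j2]; rewrite /vel.
by case: eqP => [|_]; [lia|case: eqP => [|//]; lia].
Qed.

Lemma vel_incr j : inJ V j -> inJ V (j + 1) -> vel V j < vel V (j + 1).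
Proof.
move=> jJ j1J; rewrite !velE // addrK.
by have := dv_gt0 jJ; have := dv_gt0 j1J; rewrite /dv addrK; lra.
Qed.

(** 0 is an interface, so it is interior to no cell; [maxwellian_of] divides by these midpoints. *)
Lemma vel_neq0 j : inJ V j -> vel V j != 0.
Proof.
move=> jJ; rewrite velE // mulf_neq0 ?invr_neq0 ?pnatr_eq0 //.
have /andP[j1 j2] := jJ.
have mono k l : - L <= k -> k <= l -> l <= L -> vface V k <= vface V l.
  move=> k1; rewrite le_eqVlt => /predU1P[->//|kl] l2.
  exact/ltW/vface_incr.
have d := dv_gt0 jJ; rewrite /dv in d.
have [j0|j0] := leP 1 j.
  have : vface V 0 <= vface V (j - 1) by apply: mono; lia.
  by rewrite vface_mid => H; rewrite gt_eqF //; lra.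
have : vface V j <= vface V 0 by apply: mono; lia.
by rewrite vface_mid => H; rewrite lt_eqF //; lra.
Qed.

Lemma vface_odd j : inJstar V j -> vface V (- j) = - vface V j.
Proof.
move=> /andP[j1 j2]; have [j0|j0] := leP 0 j.
  by rewrite [in RHS]vface_sym ?opprK ?j0.
by rewrite vface_sym ?opprK //; lia.
Qed.

(** Reflection in velocity acts on cells by j -> 1 - j, but on interfaces by j -> - j. *)
Lemma dv_sym j : inJ V j -> dv V (1 - j) = dv V j.
Proof.
move=> /andP[j1 j2]; rewrite /dv.
have -> : 1 - j = - (j - 1) by lia.
have -> : - (j - 1) - 1 = - j by lia.
by rewrite !vface_odd /inJstar; [ring|lia|lia].
Qed.

Lemma vel_odd j : inJ V j -> vel V (1 - j) = - vel V j.
Proof.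
move=> jJ; have /andP[j1 j2] := jJ; rewrite !velE //; last by rewrite /inJ; lia.
have -> : 1 - j = - (j - 1) by lia.
have -> : - (j - 1) - 1 = - j by lia.
by rewrite !vface_odd /inJstar; [ring|lia|lia].
Qed.

Lemma sumJ_telescope (F : int -> R) :
  sumJ V (fun j => F (j - 1) - F j) = F (- L) - F L.
Proof.
rewrite sumJE -(big_mkord xpredT (fun k => F (cell k - 1) - F (cell k))).
rewrite (telescope_sumr_eq (fun k : nat => - F (k%:Z - L))) //.
  by rewrite opprK [LHS]addrC; congr (F _ - F _); lia.
by move=> k _; rewrite opprK [RHS]addrC; congr (F _ - F _); rewrite /cell; lia.
Qed.

Lemma sumJ_refl (F : int -> R) : sumJ V F = sumJ V (fun j => F (1 - j)).
Proof.
rewrite !sumJE (reindex_inj rev_ord_inj); apply: eq_bigr => k _ /=.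
by congr F; rewrite /cell; have := ltn_ord k; lia.
Qed.

Lemma A_BGK_mean_vel m2lo m2hi m4hi (M : int -> R) :
  A_BGK V m2lo m2hi m4hi M -> sumJ V (fun j => vel V j * M j * dv V j) = 0.
Proof.
move=> [_ Msym _ _ _].
have Msym' j : inJ V j -> M (1 - j) = M j.
  move=> /andP[j1 j2]; have [j0|j0] := leP 1 j.
    by rewrite [RHS]Msym ?j0 //; congr M; lia.
  by rewrite Msym; [congr M|]; lia.
set s := sumJ _ _; suff : s = - s by lra.
rewrite {1}/s sumJ_refl /s !sumJE -sumrN; apply: eq_bigr => k _.
have kJ := inJ_cell (ltn_ord k).
by rewrite vel_odd // dv_sym // Msym' //; ring.
Qed.

Lemma maxwellian_ofE (Ms : int -> R) j : inJ V j ->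
  Ms (j - 1) - Ms j = vel V j * (maxwellian_of V Ms j * dv V j).
Proof.
move=> jJ; rewrite /maxwellian_of; field.
by rewrite vel_neq0 // gt_eqF // dv_gt0.
Qed.

End VelocityMesh.

(** The collision term is [- micro] up to weights, and g / M = rho + micro / M. The dissipation
    clause is then an equality, as the term in rho is a multiple of the zero density of [micro]. *)
Lemma bgk_collision_spec (R : realType) (X : space_mesh R) (K : finType)
    (v M dv : K -> R) (g : 'I_(xsize X) -> K -> R) (rho : 'I_(xsize X) -> R) :
  (forall k, 0 < M k) ->
  \sum_k M k * dv k = 1 -> \sum_k v k * M k * dv k = 0 ->
  rho =1 dens dv g ->
  collision_spec v M dv (fun i k => dx i * dv k * (rho i * M k - g i k)) g.
Proof.
move=> M0 M1 Mv rhoE; split=> i.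
- have -> : \sum_k dx i * dv k * (rho i * M k - g i k) =
      dx i * (rho i * (\sum_k M k * dv k) - \sum_k 1 * dv k * g i k).
    rewrite mulr_sumr -sumrB mulr_sumr.
    by apply: eq_bigr => k _; ring.
  by rewrite M1 mulr1 rhoE subrr mulr0.
- have -> : \sum_k v k * (dx i * dv k * (rho i * M k - g i k)) =
      dx i * (rho i * (\sum_k v k * M k * dv k) - \sum_k v k * dv k * g i k).
    rewrite mulr_sumr -sumrB mulr_sumr.
    by apply: eq_bigr => k _; ring.
  by rewrite Mv mulr0 sub0r mulrN.
- have -> : \sum_k dx i * dv k * (rho i * M k - g i k) * (g i k / M k) =
      - (dx i * (\sum_k dv k * (micro M dv g i k ^+ 2 / M k)
                 + rho i * \sum_k 1 * dv k * micro M dv g i k)).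
    rewrite mulr_sumr -big_split mulr_sumr -sumrN.
    by apply: eq_bigr => k _; rewrite /= /micro rhoE; field; rewrite gt_eqF.
  by rewrite -/(vmom dv (fun=> 1) _ i) -/(dens _ _ _) dens_micro // mulr0 addr0.
Qed.

Lemma fokker_planck_collision_spec (R : realType) (V : velocity_mesh R)
    (X : space_mesh R) (Ms : int -> R) (f : 'I_(xsize X) -> int -> R)
    (M := maxwellian_of V Ms) (K := 'I_(vsize V).*2) :
  Ms (vsize V)%:Z = 0 -> Ms (- (vsize V)%:Z) = 0 ->
  (forall j, inJ V j -> 0 < M j) ->
  sumJ V (fun j => M j * dv V j) = 1 ->
  collision_spec
    (fun k : K => vel V (cell V k)) (fun k : K => M (cell V k))
    (fun k : K => dv V (cell V k))
    (fun i (k : K) => FP_flux V Ms f i (cell V k)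
      - FP_flux V Ms f i (cell V k - 1))
    (fun i (k : K) => f i (cell V k)).
Proof.
move=> MsR MsL M0 M1.
(* Face k is the left interface of cell k; the right one carries the same integer index as the
   cell. *)
pose face (k : nat) : int := k%:Z - (vsize V)%:Z.
have cellE k : cell V k = face k.+1 by rewrite /cell /face; lia.
have cellB1 k : cell V k - 1 = face k by rewrite /cell /face; lia.
have faceS k : face k.+1 + 1 = cell V k.+1 by rewrite /cell /face; lia.
have face_max : face (vsize V).*2 = (vsize V)%:Z by rewrite /face; lia.
have face_0 : face 0%N = - (vsize V)%:Z by rewrite /face; lia.
(* With [p] a probability and [q = f / M], the [p]-mean of [q] is the density. *)
pose p k := M (cell V k) * dv V (cell V k).
pose v k := vel V (cell V k); pose a k := Ms (face k).
pose q i k := f i (cell V k) / M (cell V k).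
pose G i k := FP_flux V Ms f i (face k).
have L_gt0 : (0 < (vsize V).*2)%N by rewrite double_gt0 vsize_ge1.
have v_incr k : (k.+1 < (vsize V).*2)%N -> v k < v k.+1.
  move=> k1; rewrite /v -faceS -cellE.
  by rewrite vel_incr ?inJ_cell ?cellE ?faceS ?inJ_cell // ltnW.
have p_ge0 k : (k < (vsize V).*2)%N -> 0 <= p k.
  by move=> kL; rewrite mulr_ge0 // ltW ?M0 ?dv_gt0 ?inJ_cell.
have av k : (k < (vsize V).*2)%N -> a k - a k.+1 = v k * p k.
  by move=> kL; rewrite /a -cellE -cellB1 (maxwellian_ofE Ms (inJ_cell kL)).
have a0 : a 0%N = 0 by rewrite /a face_0.
have am : a (vsize V).*2 = 0 by rewrite /a face_max.
have G0 i : G i 0%N = 0 by rewrite /G /FP_flux face_0 eqxx.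
have Gm i : G i (vsize V).*2 = 0 by rewrite /G /FP_flux face_max eqxx orbT.
have GE i k : (k.+1 < (vsize V).*2)%N ->
    G i k.+1 = a k.+1 * (q i k.+1 - q i k) * (dx i / (v k.+1 - v k)).
  move=> kL; rewrite /G /FP_flux ifF; last by rewrite /face; lia.
  by rewrite /dvface /a faceS -cellE.
have spec i := fokker_planck_flux_spec (dx_gt0 i) L_gt0 v_incr p_ge0 av a0 am M1
  (G0 i) (Gm i) (GE i).
have pq i (k : K) : p k * (f i (cell V k) / M (cell V k)) =
    dv V (cell V k) * f i (cell V k).
  by rewrite /p; field; rewrite gt_eqF // M0 // inJ_cell.
have CE i k : FP_flux V Ms f i (cell V k) - FP_flux V Ms f i (cell V k - 1) =
    G i k.+1 - G i k by rewrite cellB1 cellE.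
split=> i; have [S0 S1 S2] := spec i.
- by rewrite -[RHS]S0; apply: eq_bigr => k _; rewrite CE.
- under eq_bigr => k _ do rewrite CE.
  rewrite S1; congr (- (_ * _)); apply: eq_bigr => k _.
  by rewrite pq mulrA.
- under eq_bigr => k _ do rewrite CE.
  apply: le_trans S2 _; rewrite le_eqVlt; apply/orP; left; apply/eqP.
  congr (- (_ * _)); apply: eq_bigr => k _.
  under eq_bigr => l _ do rewrite pq.
  rewrite /micro /dens /vmom /p /q.
  under [in RHS]eq_bigr => l _ do rewrite mul1r.
  by field; rewrite gt_eqF // M0 // inJ_cell.
Qed.

(** * Decay for the two schemes *)

Section SchemeDecay.
Variables (R : realType) (m2lo m2hi m4hi dtmax : R).
Hypotheses (m2lo_gt0 : 0 < m2lo) (m2lo_le : m2lo <= m2hi).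
Hypothesis (dtmax_gt0 : 0 < dtmax).

(** Square root of the abstract decay: the factor 4 becomes 2 and the rate is halved. *)
Lemma scheme_decay :
  exists2 beta : R, 0 < beta &
  forall (V : velocity_mesh R) (X : space_mesh R) (M : int -> R),
    odd (xsize X) ->
    (forall j, inJ V j -> 0 < M j) ->
    sumJ V (fun j => M j * dv V j) = 1 ->
    sumJ V (fun j => vel V j * M j * dv V j) = 0 ->
    m2lo <= moment V M 2 <= m2hi -> moment V M 4 <= m4hi ->
  forall (eps dt : R) (f C : nat -> 'I_(xsize X) -> int -> R),
    0 < eps < 1 -> 0 < dt <= dtmax ->
    (forall n i j, inJ V j ->
      eps * dx i * dv V j * (f n.+1 i j - f n i j)
      + dt * (transport_flux V (f n.+1) i j
              - transport_flux V (f n.+1) (ord_pred i) j)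
      = dt / eps * C n i j) ->
    (forall n (K := 'I_(vsize V).*2), collision_spec
      (fun k : K => vel V (cell V k)) (fun k : K => M (cell V k))
      (fun k : K => dv V (cell V k)) (fun i (k : K) => C n i (cell V k))
      (fun i (k : K) => f n.+1 i (cell V k))) ->
  forall n : nat,
    dist_eq V M f n <= 2 * dist_eq V M f 0 * expR (- (beta / 2) * (n%:R * dt)).
Proof.
have [beta beta0 H] := hypocoercive_decay m4hi m2lo_gt0 m2lo_le dtmax_gt0.
exists beta => // V X M oddX M0 M1 Mv m2b m4b eps dt f C epsb dtb Hs HC n.
pose K := 'I_(vsize V).*2.
pose v (k : K) := vel V (cell V k).
pose N (k : K) := M (cell V k).
pose d (k : K) := dv V (cell V k).
have N0 k : 0 < N k by apply/M0/inJ_cell.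
have d0 k : 0 < d k by apply/dv_gt0/inJ_cell.
have N1 : \sum_k N k * d k = 1 := M1.
have Nv : \sum_k v k * N k * d k = 0 := Mv.
have Nm2 : mom2 v N d = moment V M 2.
  by apply: eq_bigr => k _; rewrite real_normK ?num_real.
have Nm4 : mom4 v N d = moment V M 4.
  apply: eq_bigr => k _.
  by rewrite (exprM `|_| 2 2) real_normK ?num_real // -exprM.
pose mu := mass V (f 0%N).
(* Subtracting the equilibrium makes the density mean-zero, as the antiderivative requires. *)
pose g n i (k : K) := f n i (cell V k) - mu * N k.
have Hg m : kstep v d eps dt (fun i k => C m i (cell V k)) (g m) (g m.+1).
  apply: kstep_shift => i k.
  rewrite -Hs ?inJ_cell //; congr (_ + dt * _).
  by rewrite dx_cdiff /transport_flux ord_predK /v /d; ring.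
have HCg m : collision_spec v N d (fun i k => C m i (cell V k)) (g m.+1).
  exact: collision_spec_shift.
have g0 : mean (dens d (g 0%N)) = 0.
  have E i : dens d (g 0%N) i =
      \sum_(k : K) d k * f 0%N i (cell V k) + - mu * 1.
    rewrite -N1 mulr_sumr -big_split; apply: eq_bigr => k _ /=.
    by rewrite /g; ring.
  have -> : mean (dens d (g 0%N)) =
      mean (fun i => \sum_(k : K) d k * f 0%N i (cell V k) + - mu * 1).
    by apply: eq_bigr => i _; rewrite E.
  rewrite mean_comb mean_const mulr1; apply/eqP; rewrite subr_eq0; apply/eqP.
  apply: eq_bigr => i _; rewrite mulr_sumr.
  by apply: eq_bigr => k _; rewrite /d; ring.
rewrite -Nm2 in m2b; rewrite -Nm4 in m4b.
have := H X K v N d oddX N0 d0 N1 Nv m2b m4b eps dt g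
  (fun m i k => C m i (cell V k)) epsb dtb Hg HCg g0 n.
have distE m : dist_eq V M f m = Num.sqrt (wnorm2 N d (g m)) by [].
rewrite !distE => Hn; apply: le_trans (ler_wsqrtr Hn) _.
have w0 := wnorm2_ge0 N0 d0 (g 0%N).
rewrite sqrtrM ?mulr_ge0 // sqrtrM //.
have -> : Num.sqrt 4 = 2 :> R.
  by rewrite (_ : 4 = 2 ^+ 2) ?sqrtr_sqr ?ger0_norm //; ring.
rewrite ler_wpM2l ?mulr_ge0 ?sqrtr_ge0 //.
have -> : - beta * (n%:R * dt) = - (beta / 2) * (n%:R * dt) *+ 2.
  by rewrite mulr2n; field.
by rewrite -mulr_natr expRM_natr sqrtr_sqr ger0_norm // expR_ge0.
Qed.

End SchemeDecay.

Theorem theorem2 (R : realType) (m2lo m2hi m4hi dtmax : R)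
    (m2lo_gt0 : 0 < m2lo) (m2lo_le : m2lo <= m2hi) (dtmax_gt0 : 0 < dtmax) :
  (exists C beta : R, [/\ 1 <= C, 0 < beta &
     forall (V : velocity_mesh R) (X : space_mesh R) (Ms : int -> R),
       odd (xsize X) -> A_FP V m2lo m2hi m4hi Ms ->
     forall (eps dt : R) (f : nat -> 'I_(xsize X) -> int -> R),
       0 < eps < 1 -> 0 < dt <= dtmax -> FP_scheme V Ms eps dt f ->
     forall n : nat,
       dist_eq V (maxwellian_of V Ms) f n
       <= C * dist_eq V (maxwellian_of V Ms) f 0
            * expR (- (beta / 2) * (n%:R * dt))])
  /\
  (exists C beta : R, [/\ 1 <= C, 0 < beta &
     forall (V : velocity_mesh R) (X : space_mesh R) (M : int -> R),
       odd (xsize X) -> A_BGK V m2lo m2hi m4hi M ->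
     forall (eps dt : R) (f : nat -> 'I_(xsize X) -> int -> R),
       0 < eps < 1 -> 0 < dt <= dtmax -> BGK_scheme V M eps dt f ->
     forall n : nat,
       dist_eq V M f n
       <= C * dist_eq V M f 0 * expR (- (beta / 2) * (n%:R * dt))]).
Proof.
have [beta beta0 H] := scheme_decay m4hi m2lo_gt0 m2lo_le dtmax_gt0.
split; exists 2, beta; split; rewrite ?ler1n // => V X.
- move=> Ms oddX [_ [MsR MsL] M0 M1 [m2b m4b]] eps dt f epsb dtb Hf.
  set M := maxwellian_of V Ms in M0 M1 m2b m4b *.
  (* The summands are differences of interface values, which telescope between two zero end
     values. *)
  have Mv : sumJ V (fun j => vel V j * M j * dv V j) = 0.
    rewrite (eq_sumJ (G := fun j => Ms (j - 1) - Ms j)) => [|j jJ].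
      by rewrite sumJ_telescope MsR MsL subrr.
    by rewrite (maxwellian_ofE Ms jJ) mulrA.
  apply: (H V X M oddX M0 M1 Mv m2b m4b eps dt f
    (fun n i j => FP_flux V Ms (f n.+1) i j
                  - FP_flux V Ms (f n.+1) i (j - 1))) => //.
  by move=> n K; apply: fokker_planck_collision_spec.
- move=> M oddX HM; have Mv := A_BGK_mean_vel HM; case: HM => M0 _ M1 m2b m4b.
  move=> eps dt f epsb dtb Hf.
  apply: (H V X M oddX M0 M1 Mv m2b m4b eps dt f
    (fun n i j => dx i * dv V j
                  * (density V (f n.+1) i * M j - f n.+1 i j))) => //.
    by move=> n i j jJ; rewrite Hf // !mulrA.
  move=> n K; apply: bgk_collision_spec => //.
    by move=> k; apply/M0/inJ_cell.
  by move=> i; apply: eq_bigr => k _; rewrite mul1r.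
Qed.
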